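(* Let $n \geq 2$ be an integer and let $\mathcal{B}'(n) = \{(a,b,x,y)\in\mathbb{N}^4 : ax+by=n \text{ and } \gcd(a,b)=\gcd(x,y)=1\}$. Let $f:\mathbb{Z}^4\to\mathbb{C}$ be a function such that $$f(a,b,x,y)-f(x,y,a,b)= f(-a,-b,x,y)- f(x,y,-a,-b)$$ for all $a,b,x,y\in\mathbb{Z}$. Then $$\sum_{(a,b,x,y)\in \mathcal{B}'(n)} \bigl( f(a,b,x,-y)-f(a,-b,x,y)+f(a,a-b,x+y,y)-f(a,a+b,y-x,y)+f(b-a,b,x,x+y)-f(a+b,b,x,x-y) \bigr)$$ $$=\sum_{\substack{1\leq t< n\\ \gcd(t,n)=1}} \bigl( f(1,0,n,t)-f(n,t,1,0)+f(0,1,t,n)-f(t,n,0,1)+f(1,1,n-t,-t)-f(n-t,-t,1,1) \bigr).$$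
   Context: $\mathbb{N}$ denotes the set of positive integers, $\mathbb{Z}$ the integers and $\mathbb{C}$ the complex numbers. The sum over $t$ runs over integers $t$. *)

(* Defs.v *)
From mathcomp Require Import all_boot all_order all_algebra.
From mathcomp Require Import boolp classical_sets functions cardinality fsbigop reals complex zify.

Set Implicit Arguments.
Unset Strict Implicit.
Unset Printing Implicit Defensive.

Import Order.TTheory GRing.Theory Num.Theory.

Local Open Scope classical_set_scope.
Local Open Scope ring_scope.

(* The positive integers are taken inside int, so that the differences such as
   a - b and y - x fed to f : Z^4 -> C are honest integer subtractions. *)
Definition Bprime (n : nat) : set (int * int * int * int) :=
  [set p | let: (a, b, x, y) := p in
    [/\ [/\ 0 < a, 0 < b, 0 < x & 0 < y],
        a * x + b * y = n%:Z,
        gcdz a b = 1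
      & gcdz x y = 1]].

(* A sum \sum_(p \in A) F p over a classical set is the usual one only when F
   has finite support on A; it does here because Bprime n is finite. *)
Lemma finite_Bprime (n : nat) : finite_set (Bprime n).
Proof.
pose g (q : 'I_n.+1 * 'I_n.+1 * 'I_n.+1 * 'I_n.+1) : int * int * int * int :=
  let: (a, b, x, y) := q in (a%:Z, b%:Z, x%:Z, y%:Z).
apply: (@sub_finite_set _ _ (g @` setT)); last first.
  by apply: finite_image; exact: finite_finset.
move=> [[[a b] x] y] [[a0 b0 x0 y0] e _ _].
have la : (absz a < n.+1)%N by nia.
have lb : (absz b < n.+1)%N by nia.
have lx : (absz x < n.+1)%N by nia.
have ly : (absz y < n.+1)%N by nia.
exists (Ordinal la, Ordinal lb, Ordinal lx, Ordinal ly) => //=.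
by rewrite !gez0_abs // ltW.
Qed.

(* Main.v *)
Require Import Defs.
From mathcomp Require Import all_boot all_order all_algebra.
From mathcomp Require Import boolp classical_sets functions cardinality fsbigop reals complex.
From mathcomp Require Import zify ring.

Set Implicit Arguments.
Unset Strict Implicit.
Unset Printing Implicit Defensive.

Import Order.TTheory GRing.Theory Num.Theory.

Local Open Scope classical_set_scope.
Local Open Scope ring_scope.

(** Put [g a b x y = f a b x y - f x y a b]. Then [g] changes sign when the
pairs [(a, b)] and [(x, y)] are exchanged, and the hypothesis on [f] says that
[g] is even in [(a, b)], hence also even in [(x, y)]. The solution set is
stable under the exchange [(a, b, x, y) -> (x, y, a, b)] and under the
reversal [(a, b, x, y) -> (b, a, y, x)], so the six terms of the left-hand side
regroup into the sum of
[g a b x (- y) + g a (a - b) (x + y) y + g (b - a) b x (x + y)].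

In the second of these terms, split the solutions according to the sign of
[a - b] ([sum_shear]). If [a = b], coprimality forces [a = b = 1] and the
solutions are parametrised by the units [t] modulo [n]; this gives the boundary
term [g 1 0 n t]. The part [b < a] is its own opposite, through the involution
[(a, b, x, y) -> (x + y, x, b, a - b)]. On the part [a < b] the shear
[(a, b, x, y) -> (a, b - a, x + y, y)] is a bijection onto the solutions with
[y < x], and the summand becomes [g a (- b) x y]. The third term reduces to the
second one by reversal; it gives [g 0 1 t n] and the sum of [g a (- b) x y]
over the solutions with [x < y].

Hence the second and third terms together produce, besides the boundary terms,
the sum of [g a (- b) x y] over all solutions with [x <> y]. Over all solutions
this sum is the opposite of the sum of [g a b x (- y)], by exchange; the
missing solutions [x = y = 1] account for the last boundary term
[g 1 1 (n - t) (- t)]. *)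

(** * Reindexing finite sums *)

Lemma big_seq_bij (V : nmodType) (T U : eqType) (s : seq T) (r : seq U)
    (P : pred T) (Q : pred U) (h : T -> U) (k : U -> T) (F : U -> V) :
  uniq s -> uniq r ->
  (forall p, p \in s -> P p -> [/\ h p \in r, Q (h p) & k (h p) = p]) ->
  (forall q, q \in r -> Q q -> [/\ k q \in s, P (k q) & h (k q) = q]) ->
  \sum_(p <- s | P p) F (h p) = \sum_(q <- r | Q q) F q.
Proof.
move=> us ur hP kQ.
rewrite -big_filter -[RHS]big_filter -(big_map h xpredT F).
apply: perm_big; apply: uniq_perm; last 1 first.
- move=> q; rewrite mem_filter; apply/mapP/andP.
  + case=> p; rewrite mem_filter => /andP[Pp sp] ->.
    by have [-> ->] := hP p sp Pp.
  + case=> Qq rq; have [sk Pk hk] := kQ q rq Qq.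
    by exists (k q); rewrite ?mem_filter ?Pk.
- rewrite map_inj_in_uniq ?filter_uniq // => p1 p2.
  rewrite !mem_filter => /andP[P1 s1] /andP[P2 s2] e.
  by have [_ _ <-] := hP p1 s1 P1; rewrite e; have [_ _ ->] := hP p2 s2 P2.
- exact: filter_uniq.
Qed.

Lemma big_trichotomy (V : nmodType) (T : Type) (s : seq T) (u v : T -> int)
    (F : T -> V) :
  \sum_(p <- s) F p = \sum_(p <- s | u p == v p) F p
    + \sum_(p <- s | u p < v p) F p + \sum_(p <- s | v p < u p) F p.
Proof.
rewrite (bigID (fun p => u p == v p)) /= -addrA; congr (_ + _).
rewrite (bigID (fun p => u p < v p)) /=.
by congr (_ + _); apply: eq_bigl => p; case: ltgtP.
Qed.

(** * The solution set and its symmetries *)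

Lemma Bprime_swap (n : nat) (a b x y : int) :
  Bprime n (a, b, x, y) -> Bprime n (x, y, a, b).
Proof. by move=> [[a0 b0 x0 y0] e ab xy]; split=> //; rewrite -e; ring. Qed.

Lemma Bprime_rev (n : nat) (a b x y : int) :
  Bprime n (a, b, x, y) -> Bprime n (b, a, y, x).
Proof.
move=> [[a0 b0 x0 y0] e ab xy].
by split; rewrite ?(gcdzC b) ?(gcdzC y) // -e; ring.
Qed.

Lemma Bprime_shear (n : nat) (a b x y : int) : a < b ->
  Bprime n (a, b, x, y) -> Bprime n (a, b - a, x + y, y).
Proof.
move=> ltab [[a0 b0 x0 y0] e ab xy]; split.
- by split; lia.
- by rewrite -e; ring.
- by rewrite -gcdzDr subrK.
- by rewrite gcdzC gcdzDr gcdzC.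
Qed.

Lemma Bprime_unshear (n : nat) (a b x y : int) : y < x ->
  Bprime n (a, b, x, y) -> Bprime n (a, a + b, x - y, y).
Proof.
move=> ltyx /Bprime_rev/Bprime_swap/(Bprime_shear ltyx)/Bprime_swap/Bprime_rev.
by rewrite (addrC b).
Qed.

(** The map [(a, b, x, y) -> (x + y, x, b, a - b)], an involution of the solutions
with [b < a]; it exchanges the pairs [(a, a - b)] and [(x + y, y)]. *)
Lemma Bprime_involution (n : nat) (a b x y : int) : b < a ->
  Bprime n (a, b, x, y) -> Bprime n (x + y, x, b, a - b).
Proof.
move=> ltba /Bprime_rev/(Bprime_shear ltba)/Bprime_swap.
by rewrite (addrC y).
Qed.

(** The elements of [Bprime n], listed without repetition. *)
Definition solutions (n : nat) : seq (int * int * int * int) :=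
  finmap.enum_fset (fset_set (Bprime n)).

Lemma solutionsP (n : nat) (p : int * int * int * int) :
  reflect (Bprime n p) (p \in solutions n).
Proof.
by rewrite /solutions in_fset_set ?inE; [exact: asboolP | exact: finite_Bprime].
Qed.

Lemma solutions_uniq (n : nat) : uniq (solutions n).
Proof. exact: finmap.fset_uniq. Qed.

Lemma sum_swap (V : nmodType) (n : nat) (P : pred (int * int * int * int))
    (F : int * int * int * int -> V) :
  \sum_(p <- solutions n | let: (a, b, x, y) := p in P (x, y, a, b))
     (let: (a, b, x, y) := p in F (x, y, a, b))
  = \sum_(p <- solutions n | P p) F p.
Proof.
pose h (p : int * int * int * int) := let: (a, b, x, y) := p in (x, y, a, b).
rewrite -(@big_seq_bij _ _ _ (solutions n) (solutions n) (P \o h) P h h F)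
  ?solutions_uniq //.
- by apply: eq_big => -[[[]]].
all: by move=> [[[a b] x] y] /solutionsP/Bprime_swap/solutionsP.
Qed.

Lemma sum_rev (V : nmodType) (n : nat) (P : pred (int * int * int * int))
    (F : int * int * int * int -> V) :
  \sum_(p <- solutions n | let: (a, b, x, y) := p in P (b, a, y, x))
     (let: (a, b, x, y) := p in F (b, a, y, x))
  = \sum_(p <- solutions n | P p) F p.
Proof.
pose h (p : int * int * int * int) := let: (a, b, x, y) := p in (b, a, y, x).
rewrite -(@big_seq_bij _ _ _ (solutions n) (solutions n) (P \o h) P h h F)
  ?solutions_uniq //.
- by apply: eq_big => -[[[]]].
all: by move=> [[[a b] x] y] /solutionsP/Bprime_rev/solutionsP.
Qed.

(** The solutions with [a = b] are the quadruples [(1, 1, n - t, t)], where [t]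
is prime to [n]. *)
Lemma sum_diagonal (V : nmodType) (n : nat) (F : int * int * int * int -> V) :
  \sum_(p <- solutions n | p.1.1.1 == p.1.1.2) F p
  = \sum_(1 <= t < n | coprime t n) F (1, 1, n%:Z - t%:Z, t%:Z).
Proof.
symmetry.
apply: (@big_seq_bij _ _ _ _ _ _ _
  (fun t : nat => (1, 1, n%:Z - t%:Z, t%:Z)) (fun p => absz p.2)).
- exact: iota_uniq.
- exact: solutions_uniq.
- move=> t; rewrite mem_index_iota => /andP[t1 tn] ctn; split=> //.
  apply/solutionsP; split.
  + by split=> //; lia.
  + by ring.
  + by [].
  + rewrite gcdzC -gcdzDr subrK /gcdz !absz_nat.
    by move: ctn; rewrite /coprime => /eqP ->.
- move=> [[[a b] x] y] /solutionsP[[a0 b0 x0 y0] e ab xy] /= /eqP eab.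
  rewrite -{}eab in e ab *.
  have a1 : a = 1 by move: ab; rewrite /gcdz gcdnn; lia.
  rewrite {a ab}a1 in a0 e *.
  have yE : (absz y)%:Z = y by lia.
  have xE : n%:Z - (absz y)%:Z = x by lia.
  split; last by rewrite xE yE.
  + by rewrite mem_index_iota; lia.
  + rewrite /coprime -eqz_nat -[X in X == _]/(gcdz (absz y)%:Z n%:Z).
    by rewrite -[n%:Z](subrK (absz y)%:Z) gcdzDr xE yE gcdzC xy.
Qed.

(** * Sheared sums of an antisymmetric function *)

(** Solutions with [a = b] give the boundary sum, those with [b < a] cancel, and
those with [a < b] are carried by the shear to the solutions with [y < x]. *)
Lemma sum_shear (V : numDomainType) (n : nat)
    (g : int -> int -> int -> int -> V)
    (g_anti : forall a b x y, g x y a b = - g a b x y) :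
  \sum_(p <- solutions n) (let: (a, b, x, y) := p in g a (a - b) (x + y) y)
  = \sum_(1 <= t < n | coprime t n) g 1 0 n%:Z t%:Z
    + \sum_(p <- solutions n | p.2 < p.1.2)
        (let: (a, b, x, y) := p in g a (- b) x y).
Proof.
rewrite (big_trichotomy _ (fun p => p.1.1.1) (fun p => p.1.1.2)).
rewrite sum_diagonal subrr.
under eq_bigr => t _ do rewrite subrK.
set S := (X in _ + _ + X).
have -> : S = 0.
  (* The sum over [b < a] equals its opposite. *)
  apply/eqP; rewrite -eqNr; apply/eqP.
  pose h (p : int * int * int * int) :=
    let: (a, b, x, y) := p in (x + y, x, b, a - b).
  have hP p : p \in solutions n -> p.1.1.2 < p.1.1.1 ->
      [/\ h p \in solutions n, (h p).1.1.2 < (h p).1.1.1 & h (h p) = p].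
    move: p => [[[a b] x] y] /solutionsP Bp /= ltba; split.
    - exact/solutionsP/Bprime_involution.
    - by move: Bp => [[_ _ _ y0] _ _ _]; rewrite ltrDl.
    - by congr (_, _, _, _); ring.
  rewrite {2}/S -(big_seq_bij _ (solutions_uniq n) (solutions_uniq n) hP hP).
  rewrite -sumrN; apply: eq_bigr => -[[[a b] x] y] _ /=.
  by rewrite -g_anti; congr g; ring.
rewrite addr0; congr (_ + _).
pose h (p : int * int * int * int) :=
  let: (a, b, x, y) := p in (a, b - a, x + y, y).
pose k (p : int * int * int * int) :=
  let: (a, b, x, y) := p in (a, a + b, x - y, y).
rewrite -(@big_seq_bij _ _ _ (solutions n) (solutions n)
  (fun p => p.1.1.1 < p.1.1.2) (fun p => p.2 < p.1.2) h k)
  ?solutions_uniq //.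
- by apply: eq_bigr => -[[[a b] x] y] _ /=; rewrite opprB.
- move=> [[[a b] x] y] /solutionsP Bp /= ltab; split.
  + exact/solutionsP/Bprime_shear.
  + by move: Bp => [[_ _ x0 _] _ _ _]; rewrite ltrDr.
  + by congr (_, _, _, _); ring.
- move=> [[[a b] x] y] /solutionsP Bp /= ltyx; split.
  + exact/solutionsP/Bprime_unshear.
  + by move: Bp => [[_ b0 _ _] _ _ _]; rewrite ltrDl.
  + by congr (_, _, _, _); ring.
Qed.

(** The identity for an antisymmetric function which is even in each pair. *)
Lemma sum_antisymmetric (V : numDomainType) (n : nat)
    (g : int -> int -> int -> int -> V)
    (g_anti : forall a b x y, g x y a b = - g a b x y)
    (g_even : forall a b x y, g (- a) (- b) x y = g a b x y) :
  \sum_(p <- solutions n)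
     (let: (a, b, x, y) := p in
      g a b x (- y) + g a (a - b) (x + y) y + g (b - a) b x (x + y))
  = \sum_(1 <= t < n | coprime t n)
     (g 1 0 n%:Z t%:Z + g 0 1 t%:Z n%:Z + g 1 1 (n%:Z - t%:Z) (- t%:Z)).
Proof.
pose G1 p := let: (a, b, x, y) := p in g a b x (- y).
pose G2 p := let: (a, b, x, y) := p in g a (a - b) (x + y) y.
pose G3 p := let: (a, b, x, y) := p in g (b - a) b x (x + y).
pose H p := let: (a, b, x, y) := p in g a (- b) x y.
have -> : \sum_(p <- solutions n)
    (let: (a, b, x, y) := p in
     g a b x (- y) + g a (a - b) (x + y) y + g (b - a) b x (x + y))
    = \sum_(p <- solutions n) G1 p + \sum_(p <- solutions n) G2 p
      + \sum_(p <- solutions n) G3 p.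
  by rewrite -!big_split; apply: eq_bigr => -[[[a b] x] y].
rewrite !big_split /=.
have G1E : \sum_(p <- solutions n) G1 p = - \sum_(p <- solutions n) H p.
  by rewrite -(sum_swap _ xpredT) -sumrN; apply: eq_big => -[[[a b] x] y] //= _.
have G2E : \sum_(p <- solutions n) G2 p
    = \sum_(1 <= t < n | coprime t n) g 1 0 n%:Z t%:Z
      + \sum_(p <- solutions n | p.2 < p.1.2) H p by exact: sum_shear.
have G3E : \sum_(p <- solutions n) G3 p
    = \sum_(1 <= t < n | coprime t n) g 0 1 t%:Z n%:Z
      + \sum_(p <- solutions n | p.1.2 < p.2) H p.
  rewrite -(sum_rev _ xpredT).
  (* Reversal turns this sum into the previous one, for [g] with both pairs
     reversed. *)
  pose gr a b x y := g b a y x.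
  have gr_anti a b x y : gr x y a b = - gr a b x y by exact: g_anti.
  have := sum_shear n gr_anti; rewrite /gr => shear_gr.
  rewrite -(sum_rev _ (fun p => p.1.2 < p.2)).
  transitivity (\sum_(p <- solutions n)
      (let: (a, b, x, y) := p in g (a - b) a y (x + y))).
    by apply: eq_big => -[[[a b] x] y] //= _; rewrite (addrC y).
  rewrite shear_gr; congr (_ + _).
  apply: eq_big => -[[[a b] x] y] //= _.
  by rewrite /H -g_even opprK.
have HE := big_trichotomy (solutions n) (fun p => p.1.2) (fun p => p.2) H.
have HD : \sum_(p <- solutions n | p.1.2 == p.2) H p
    = - \sum_(1 <= t < n | coprime t n) g 1 1 (n%:Z - t%:Z) (- t%:Z).
  rewrite -(sum_swap _ (fun p => p.1.2 == p.2)).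
  transitivity (\sum_(p <- solutions n | p.1.1.1 == p.1.1.2)
      (let: (a, b, x, y) := p in H (x, y, a, b))).
    by apply: eq_big => -[[[a b] x] y].
  by rewrite sum_diagonal -sumrN; apply: eq_bigr => t _; exact: g_anti.
by rewrite G1E G2E G3E HE HD; ring.
Qed.

(** * The identity for arbitrary functions *)

Theorem mainTheorem1 (R : realType) (n : nat) (hn : (2 <= n)%N)
    (f : int -> int -> int -> int -> R[i])
    (hf : forall a b x y : int,
        f a b x y - f x y a b = f (- a) (- b) x y - f x y (- a) (- b)) :
  \sum_(p \in Bprime n)
     (let: (a, b, x, y) := p in
      f a b x (- y) - f a (- b) x y
      + f a (a - b) (x + y) y - f a (a + b) (y - x) y
      + f (b - a) b x (x + y) - f (a + b) b x (x - y))
  = \sum_(1 <= t < n | coprime t n)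
     (f 1 0 n%:Z t%:Z - f n%:Z t%:Z 1 0
      + f 0 1 t%:Z n%:Z - f t%:Z n%:Z 0 1
      + f 1 1 (n%:Z - t%:Z) (- t%:Z) - f (n%:Z - t%:Z) (- t%:Z) 1 1).
Proof.
rewrite fsbig_finite; last exact: finite_Bprime.
rewrite -/(solutions n).
pose g a b x y := f a b x y - f x y a b.
have g_anti a b x y : g x y a b = - g a b x y by rewrite /g opprB.
have g_even a b x y : g (- a) (- b) x y = g a b x y by rewrite /g -hf.
have := sum_antisymmetric n g_anti g_even; rewrite /g => main.
transitivity (\sum_(1 <= t < n | coprime t n)
    (f 1 0 n%:Z t%:Z - f n%:Z t%:Z 1 0 + (f 0 1 t%:Z n%:Z - f t%:Z n%:Z 0 1)
     + (f 1 1 (n%:Z - t%:Z) (- t%:Z) - f (n%:Z - t%:Z) (- t%:Z) 1 1))); last first.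
  by apply: eq_bigr => t _; rewrite !addrA.
rewrite -main.
(* After exchange of the two pairs, [B1], [B3] and [B2] become the terms that
   [g] subtracts from [A1], [A2] and [A3] respectively. *)
pose A1 p := let: (a, b, x, y) := p in f a b x (- y).
pose A2 p := let: (a, b, x, y) := p in f a (a - b) (x + y) y.
pose A3 p := let: (a, b, x, y) := p in f (b - a) b x (x + y).
pose B1 p := let: (a, b, x, y) := p in f a (- b) x y.
pose B2 p := let: (a, b, x, y) := p in f a (a + b) (y - x) y.
pose B3 p := let: (a, b, x, y) := p in f (a + b) b x (x - y).
pose sw (p : int * int * int * int) := let: (a, b, x, y) := p in (x, y, a, b).
pose S F := \sum_(p <- solutions n) (F p : R[i]).
have swE F : S (F \o sw) = S F.
  by rewrite /S -(sum_swap _ xpredT); apply: eq_big => -[[[a b] x] y].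
transitivity (S A1 - S B1 + S A2 - S B2 + S A3 - S B3).
  rewrite /S -!(big_split, sumrN) /=.
  by apply: eq_bigr => -[[[a b] x] y].
transitivity (S A1 - S (B1 \o sw) + (S A2 - S (B3 \o sw))
              + (S A3 - S (B2 \o sw))).
  by rewrite !swE; ring.
rewrite /S -!(big_split, sumrN) /=.
by apply: eq_bigr => -[[[a b] x] y].
Qed.
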